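(* For every positive integer $k$ there exist constants $C_k\geq 1$ and $A_k>0$, depending only on $k$, such that the following holds. For every positive integer $d$, all real numbers $\alpha_1,\dots,\alpha_d$, and every integer $N\geq1$, there exists an integer $1\leq n\leq N$ such that \[\|n^k\alpha_j\|\leq A_k \exp\bigl(-(C_k d^{5})^{-1}(\log N)^{1/C_k}\bigr)\quad\text{for } j=1,\dots,d.\]
   Context: For $\alpha\in\mathbb R$, $\|\alpha\|$ denotes the distance from $\alpha$ to the nearest integer. *)

(* Defs.v *)
From Stdlib Require Import Reals.
Open Scope R_scope.

(* ||x|| : distance from x to the nearest integer.
   With z = up x - 1 = floor x, the nearest integer is z or z+1. *)
Definition dist_nint (x : R) : R :=
  Rmin (x - IZR (up x - 1)) (IZR (up x) - x).

(* x ^ y for real exponent, with the convention 0 ^ y = 0 (y > 0),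
   i.e. x^y = Rpower x y for x > 0 and 0 otherwise (only used for x >= 0). *)
Definition rpow0 (x y : R) : R := if Rle_dec x 0 then 0 else Rpower x y.

(* Main.v *)
(** A purely combinatorial argument, by induction on [k], for systems mixing
    the exponents [1..k] and with [log n] polynomial in the number of conditions
    and in the number of bits of precision.

    By the induction hypothesis one chooses [u_0, u_1, ...] successively so that
    every mixed monomial [u_i^b * (product of earlier u's) * alpha], [b < k], is
    almost an integer; then [(sum X_i u_i)^k alpha] is close to
    [sum X_i^k u_i^k alpha] modulo 1 for all small weights [X_i].  Pigeonhole
    applied to the sums of [u_i^k alpha] over index sets of fixed size, followed
    by the sunflower lemma (the core cancels), yields many disjoint nonempty
    index sets with almost equal sums, say [sigma].  Dirichlet's theorem gives
    [M > 0] with [M sigma] close to 0, and [M] is a sum of [O(log M)] perfect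
    [k]-th powers by writing it in base [2^k]; their roots, distributed over
    these index sets, are the weights. *)

Require Import Defs.
From Stdlib Require Import Reals Lra Lia ZArith.
From mathcomp Require all_boot all_order all_algebra zify ring lra Rstruct.
Open Scope R_scope.

Module Recurrence.
Import all_boot all_order all_algebra zify ring lra Rstruct.
Import Order.TTheory GRing.Theory Num.Theory.
Local Close Scope R_scope.
Local Open Scope nat_scope.
Set Implicit Arguments. Unset Strict Implicit. Unset Printing Implicit Defensive.

(** * Combinatorics: sunflowers and sums of perfect powers *)

Lemma sunflower (T : finType) (r s : nat) (F : {set {set T}}) :
    (forall A, A \in F -> #|A| = s) -> s`! * r ^ s < #|F| ->
  exists (K : {set T}) (G : {set {set T}}),
    [/\ r < #|G|, trivIset G, set0 \notin G &
        forall P, P \in G -> [disjoint K & P] /\ K :|: P \in F].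
Proof.
elim: s F => [|s IHs] F cardF ltF.
  suff: #|F| <= 1 by move: ltF; rewrite fact0 expn0; lia.
  rewrite -(cards1 (set0 : {set T})); apply/subset_leq_card/subsetP => A FA.
  by rewrite inE -cards_eq0 cardF.
pose ok (G : {set {set T}}) := (G \subset F) && trivIset G.
have ok0 : ok set0 by rewrite /ok sub0set; apply/trivIsetP => A B; rewrite inE.
(* Take a largest disjoint subfamily [G]. With more than [r] members it is a sunflower with empty
   core; otherwise its few points meet every member of [F]. *)
case: (arg_maxnP (fun G : {set {set T}} => #|G|) ok0) => G /andP[sGF tG] maxG.
have [ltG|leG] := ltnP r #|G|.
  exists set0, G; split=> // [|P GP].
    by apply/negP => /(subsetP sGF)/cardF; rewrite cards0.
  by rewrite set0U (subsetP sGF) // disjoints_subset sub0set.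
have cardU : #|cover G| <= r * s.+1.
  apply: leq_trans (leq_card_cover G) _.
  rewrite (eq_bigr (fun _ => s.+1)) => [|A /(subsetP sGF)/cardF //].
  by rewrite sum_nat_const leq_mul2r leG orbT.
have meetU A : A \in F -> exists2 x, x \in cover G & x \in A.
  move=> FA; have [|/pred0Pn[x /andP[/= Ux Ax]]] := boolP [disjoint cover G & A].
    move=> dUA; have A0 : A != set0 by rewrite -cards_eq0 cardF.
    have GA : A \notin G.
      apply: contraNN A0 => GA; rewrite -subset0; apply/subsetP => x Ax.
      have Ux : x \in cover G by apply/bigcupP; exists A.
      by rewrite (disjointFr dUA Ux) in Ax.
    have: ok (A |: G).
      rewrite /ok subUset sub1set FA sGF /=; apply/trivIsetP => B C.
      have dA B' : B' \in G -> [disjoint A & B'].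
        by move=> GB'; rewrite disjoint_sym; apply: disjointWl dUA; apply: bigcup_sup GB'.
      rewrite !inE => /predU1P[->|GB] /predU1P[->|GC]; rewrite ?eqxx // => neq.
      - exact: dA.
      - by rewrite disjoint_sym; exact: dA.
      - by move/trivIsetP: tG; apply.
    by move/maxG; rewrite /= cardsU1 GA add1n ltnn.
  by exists x.
pose Fx x := [set A in F | x \in A].
(* Double counting against the at most [r * s.+1] points of [cover G] gives a point lying in many
   members. Deleting it lowers their size by one, and it later joins the core. *)
have [x ltx] : exists x, s`! * r ^ s < #|Fx x|.
  apply/existsP; apply: contraLR ltF; rewrite negb_exists => /forallP small.
  rewrite -leqNgt; apply: (@leq_trans (\sum_(x in cover G) #|Fx x|)).
    rewrite (eq_bigr (fun x => \sum_(A in F) (x \in A : nat))); last first.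
      move=> x _; rewrite -sum1_card big_mkcond [RHS]big_mkcond /=.
      by apply: eq_bigr => A _; rewrite inE; case: (A \in F).
    rewrite exchange_big /= -sum1_card; apply: leq_sum => A /meetU[x Ux Ax].
    by rewrite (bigD1 x) //= Ax.
  apply: (@leq_trans (\sum_(x in cover G) s`! * r ^ s)).
    by apply: leq_sum => x _; rewrite leqNgt.
  rewrite sum_nat_const factS expnS.
  have -> : s.+1 * s`! * (r * r ^ s) = r * s.+1 * (s`! * r ^ s) by ring.
  by rewrite leq_mul2r cardU orbT.
have injD : {in Fx x &, injective (fun A => A :\ x)}.
  move=> A B; rewrite !inE => /andP[_ Ax] /andP[_ Bx] eqAB.
  by rewrite -(setD1K Ax) -(setD1K Bx) eqAB.
have [||K [H [ltH tH H0 KH]]] := IHs [set A :\ x | A in Fx x].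
- move=> _ /imsetP[A /[!inE]/andP[/cardF cA Ax] ->].
  by have := cardsD1 x A; rewrite Ax cA; lia.
- by rewrite card_in_imset.
exists (x |: K), H; split=> // P HP.
have [dKP /imsetP[A /[!inE]/andP[FA Ax] eqA]] := KH P HP.
have xP : x \notin P by have /setP/(_ x) := eqA; rewrite !inE eqxx => /norP[].
split; last by rewrite -setUA eqA setD1K.
by rewrite disjoints_subset subUset sub1set inE xP -disjoints_subset.
Qed.

Lemma fact_leq_exp n : n`! <= n ^ n.
Proof.
elim: n => // n IHn; rewrite factS expnS leq_mul2l /=.
by apply: leq_trans IHn _; case: n => // n; rewrite leq_exp2r.
Qed.

Lemma ffact_geq_exp n m : (n - m) ^ m <= n ^_ m.
Proof.
elim: m n => // m IHm [|n]; first by rewrite sub0n exp0n.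
rewrite subSS ffactSS expnS leq_mul //.
by lia.
Qed.

(** Apply the sunflower lemma to the most frequent colour among the subsets of size [s = t + 1]. The
    size of [T] makes [(#|T| - s) ^ s] equal to [2 ^ s * s ^ (2 * s) * r ^ s]; since [s > t], this
    exceeds [2 ^ t * s! ^ 2 * r ^ s], the bound that holds if every colour class is small. *)
Lemma monochromatic_petals (T C : finType) (color : {set T} -> C) (t r : nat) :
    #|C| <= 2 ^ t -> #|T| = t.+1 + 2 * t.+1 ^ 2 * r -> 0 < r ->
  exists (K : {set T}) (G : {set {set T}}),
    [/\ r < #|G|, trivIset G, set0 \notin G,
        forall P, P \in G -> [disjoint K & P] &
        forall P Q, P \in G -> Q \in G -> color (K :|: P) = color (K :|: Q)].
Proof.
move=> cardC cardT r0; set s := t.+1 in cardT *.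
pose S (c : C) := [set A : {set T} | (#|A| == s) && (color A == c)].
have [c ltc] : exists c, s`! * r ^ s < #|S c|.
  apply/existsP; apply: contraT; rewrite negb_exists => /forallP small.
  have le1 : 'C(#|T|, s) <= 2 ^ t * (s`! * r ^ s).
    rewrite -card_draws -sum1_card (partition_big color predT) //=.
    apply: leq_trans (leq_mul cardC (leqnn _)).
    rewrite -sum_nat_const; apply: leq_sum => c _.
    apply: leq_trans (_ : #|S c| <= _); last by rewrite leqNgt.
    by rewrite -sum1_card; apply: eq_leq; apply: eq_bigl => A; rewrite !inE.
  have le2 : (2 * s ^ 2 * r) ^ s <= 2 ^ t * (s`! * r ^ s) * s`!.
    apply: leq_trans (_ : 'C(#|T|, s) * s`! <= _); last by rewrite leq_mul2r le1 orbT.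
    by rewrite bin_ffact; have := ffact_geq_exp #|T| s; rewrite cardT addKn.
  have le3 : 2 ^ t * (s`! * r ^ s) * s`! <= 2 ^ t * (s ^ s * s ^ s * r ^ s).
    have -> : 2 ^ t * (s`! * r ^ s) * s`! = 2 ^ t * (s`! * s`! * r ^ s) by ring.
    by rewrite leq_mul2l leq_mul2r leq_mul ?fact_leq_exp ?orbT.
  have: (2 * s ^ 2 * r) ^ s = 2 * (2 ^ t * (s ^ s * s ^ s * r ^ s)).
    by rewrite !expnMn {1}/s expnS; ring.
  have: 0 < 2 ^ t * (s ^ s * s ^ s * r ^ s) by rewrite !muln_gt0 !expn_gt0 r0.
  by move: (leq_trans le2 le3); lia.
have [|K [G [ltG tG G0 KG]]] := sunflower _ ltc.
  by move=> A /[!inE]/andP[/eqP].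
exists K, G; split=> // [P /KG[] //|P Q /KG[_ +] /KG[_]].
by rewrite !inE => /andP[_ /eqP->] /andP[_ /eqP->].
Qed.

(** A digit in base [2 ^ k] is a sum of that many ones, and doubling all roots multiplies the sum of
    their [k]-th powers by [2 ^ k]. *)
Lemma sum_of_powers k h M : 0 < k -> M < 2 ^ h ->
  exists2 xs : seq nat, size xs <= 2 ^ k * h & \sum_(x <- xs) x ^ k = M.
Proof.
move=> k0; elim: h M => [|h IHh] M ltM.
  by exists [::]; rewrite // big_nil; case: M ltM.
have [|xs les eqs] := IHh (M %/ 2 ^ k).
  rewrite ltn_divLR ?expn_gt0 // -expnD; apply: leq_trans ltM _.
  by rewrite leq_exp2l //; lia.
exists ([seq 2 * x | x <- xs] ++ nseq (M %% 2 ^ k) 1).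
  rewrite size_cat size_map size_nseq mulnS addnC leq_add //.
  by rewrite ltnW // ltn_mod expn_gt0.
rewrite big_cat big_map /= big_nseq exp1n iter_addn_0 mul1n.
rewrite {2}(divn_eq M (2 ^ k)) -eqs big_distrl /=; congr (_ + _).
by apply: eq_bigr => x _; rewrite expnMn mulnC.
Qed.

(** * Functions of polynomial growth *)

Definition poly_bounded (f : nat -> nat) :=
  exists e, forall x, 2 <= x -> f x <= x ^ e.

Lemma poly_bounded_id : poly_bounded id.
Proof. by exists 1 => x _; rewrite expn1. Qed.

(** The threshold 2 lets the exponent absorb constants: [c < 2 ^ c <= x ^ c]. *)
Lemma poly_bounded_const c : poly_bounded (fun=> c).
Proof.
exists c => x x2; apply: leq_trans (ltnW (ltn_expl c (ltnSn 1))) _.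
by case: c => // c; rewrite leq_exp2r.
Qed.

Lemma poly_boundedM f g :
  poly_bounded f -> poly_bounded g -> poly_bounded (fun x => f x * g x).
Proof.
by move=> [e fe] [e' ge]; exists (e + e') => x x2; rewrite expnD leq_mul ?fe ?ge.
Qed.

Lemma poly_boundedX f c : poly_bounded f -> poly_bounded (fun x => f x ^ c).
Proof.
move=> [e fe]; exists (e * c) => x x2; rewrite expnM.
by case: c => // c; rewrite leq_exp2r // fe.
Qed.

Lemma poly_boundedD f g :
  poly_bounded f -> poly_bounded g -> poly_bounded (fun x => f x + g x).
Proof.
move=> [e fe] [e' ge]; exists (e + e').+1 => x x2.
apply: leq_trans (leq_add (fe x x2) (ge x x2)) _.
have le1 : x ^ e <= x ^ (e + e') by rewrite leq_exp2l // leq_addr.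
have le2 : x ^ e' <= x ^ (e + e') by rewrite leq_exp2l // leq_addl.
apply: leq_trans (leq_add le1 le2) _.
by rewrite addnn -mul2n expnS leq_mul2r x2 orbT.
Qed.

(** * Lists of products, distribution of roots, and successive choice *)

Lemma size_allpairs_leq (S : eqType) (A B : Type) (f : S -> A -> B) (s : seq S)
    (t : S -> seq A) c : (forall x, x \in s -> size (t x) <= c) ->
  size [seq f x y | x <- s, y <- t x] <= size s * c.
Proof.
move=> tc; rewrite size_allpairs_dep sumnE big_map.
rewrite -[X in _ <= X * c]count_predT -sum1_count big_distrl /=.
by rewrite big_seq [X in _ <= X]big_seq; apply: leq_sum => x /tc; rewrite mul1n.
Qed.

Lemma sum_powers_assign (S : finType) (A : {set S}) (xs : seq nat) k : 0 < k ->
    size xs <= #|A| ->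
  (* The roots are dealt out along [enum A]. Elements beyond the list receive the default 0, whose
     power vanishes because [0 < k]. *)
  exists w : S -> nat, \sum_(a in A) w a ^ k = \sum_(x <- xs) x ^ k.
Proof.
move=> k0 lexs; exists (fun a => nth 0 xs (index a (enum A))).
rewrite big_enum_val (big_nth 0) big_mkord.
rewrite (big_ord_widen _ (fun i => nth 0 xs i ^ k) lexs) [RHS]big_mkcond /=.
apply: eq_bigr => i _; rewrite (enum_val_nth (enum_val i)) index_uniq ?enum_uniq -?cardE //.
by case: ltnP => // sxs; rewrite nth_default // exp0n.
Qed.

(** The coefficients of the monomials of degree [c] in [u 0, ..., u (i - 1)], listed with order and
    repetition so that the count is exactly [i ^ c]. *)
Fixpoint products (u : nat -> nat) i c : seq nat :=
  if c is c'.+1 then [seq u l * g | l <- iota 0 i, g <- products u i c']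
  else [:: 1].

Lemma size_products u i c : size (products u i c) = i ^ c.
Proof. by elim: c => //= c IHc; rewrite size_allpairs size_iota IHc expnS. Qed.

Lemma eq_products u v i c :
  (forall l, l < i -> u l = v l) -> products u i c = products v i c.
Proof.
move=> uv; elim: c => //= c ->; apply/eq_in_allpairs => l g.
by rewrite mem_iota => /andP[_ /uv->].
Qed.

(** Choice by recursion: a condition on the [i]-th term sees only the earlier terms, so overwriting
    the sequence at [j] preserves the conditions already met. *)
Lemma prefix_choice (P : (nat -> nat) -> nat -> nat -> Prop) m :
    (forall u v i n, (forall l, l < i -> u l = v l) -> P u i n -> P v i n) ->
    (forall u i, i < m -> exists n, P u i n) ->
  exists u, forall i, i < m -> P u i (u i).
Proof.
move=> ext ex; suff /(_ m (leqnn m)) : forall j, j <= m ->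
  exists u, forall i, i < j -> P u i (u i) by [].
elim=> [|j IHj] jm; first by exists (fun=> 0).
have [u Pu] := IHj (ltnW jm); have [n Pn] := ex u j jm.
pose v l := if l == j then n else u l.
have uv i : i <= j -> forall l, l < i -> u l = v l.
  by rewrite /v => ij l li; case: eqP => // ?; lia.
exists v => i; rewrite ltnS leq_eqVlt => /predU1P[->|ij].
  by rewrite {2}/v eqxx; apply: ext Pn; apply: uv.
by rewrite -(uv j) //; apply: ext (Pu i ij); apply/uv/ltnW.
Qed.

Local Open Scope ring_scope.

(* [M < 2 ^ weight_bits x] for the Dirichlet multiplier [M] of at most [x] reals
   at precision [2 ^- x.+2]; cells of width [2 ^- cell_bits x] keep an error
   multiplied by [M] below [2 ^- x.+2]; [num_terms] is the size required by
   [monochromatic_petals]. *)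
Definition weight_bits x := (x.+2 * x).+1.
Definition cell_bits x := (weight_bits x + x.+2)%N.
Definition num_terms K x :=
  let t := (cell_bits x * x)%N in
  (t.+1 + 2 * t.+1 ^ 2 * (2 ^ K * weight_bits x))%N.

(** This function is the exponent of 2 that bounds [n] in the passage from [k] to [k.+1]: [m + h]
    for the weighted sum of [m] terms, and the power [E] for the size of each [u i]. *)
Lemma poly_bounded_step k E :
  poly_bounded (fun x => let m := num_terms k.+1 x in let h := weight_bits x in
    let L := x.+2 + (m + (m + h) * k.+1) in
    m + h + (L + x * k * m.+1 ^ k.+1) ^ E)%N.
Proof.
have pS f : poly_bounded f -> poly_bounded (fun x => (f x).+1).
  move=> pf; have [e fe] := poly_boundedD pf (poly_bounded_const 1).
  by exists e => x /fe; rewrite addn1.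
have id := poly_bounded_id; have p2 : poly_bounded (fun x => x.+2) := pS _ (pS _ id).
have ph : poly_bounded weight_bits by apply/pS/poly_boundedM.
have pm : poly_bounded (num_terms k.+1).
  have pt : poly_bounded (fun x => (cell_bits x * x).+1).
    by apply/pS/poly_boundedM => //; apply: poly_boundedD.
  apply: poly_boundedD => //; apply: poly_boundedM; last first.
    by apply: poly_boundedM => //; apply: poly_bounded_const.
  by apply: poly_boundedM; [apply: poly_bounded_const|apply: (poly_boundedX 2)].
apply: poly_boundedD; first exact: poly_boundedD.
apply: poly_boundedX; apply: poly_boundedD.
  apply: poly_boundedD; first exact: p2.
  apply: poly_boundedD => //; apply: poly_boundedM; last exact: poly_bounded_const.
  exact: poly_boundedD.
apply: poly_boundedM; last by apply: poly_boundedX; apply: pS.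
by apply: poly_boundedM => //; apply: poly_bounded_const.
Qed.

(** * Approximate integers, circle cells and simultaneous approximation *)

Section NearInteger.
Variable R : archiRealFieldType.
Implicit Types (x y e g : R).

Definition near_int e x := exists z : int, `|x - z%:~R| <= e.

Lemma near_int_le e e' x : e <= e' -> near_int e x -> near_int e' x.
Proof. by move=> ee' [z xz]; exists z; apply: le_trans ee'. Qed.

Lemma near_int0 : near_int 0 0.
Proof. by exists 0; rewrite subrr normr0. Qed.

Lemma near_intD e e' x y :
  near_int e x -> near_int e' y -> near_int (e + e') (x + y).
Proof.
move=> [z xz] [z' yz']; exists (z + z'); rewrite intrD.
have -> : x + y - (z%:~R + z'%:~R) = (x - z%:~R) + (y - z'%:~R) by ring.
exact: le_trans (ler_normD _ _) (lerD xz yz').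
Qed.

Lemma near_intMn e x n : near_int e x -> near_int (n%:R * e) (n%:R * x).
Proof.
move=> xe; elim: n => [|n IHn]; first by rewrite !mul0r; apply: near_int0.
by rewrite -!natr1 !mulrDl !mul1r; apply: near_intD.
Qed.

Lemma near_int_sum (I : Type) (r : seq I) (P : pred I) (F e : I -> R) :
  (forall i, P i -> near_int (e i) (F i)) ->
  near_int (\sum_(i <- r | P i) e i) (\sum_(i <- r | P i) F i).
Proof.
move=> Fe; apply: (big_ind2 near_int) => //; first exact: near_int0.
by move=> *; apply: near_intD.
Qed.

Lemma near_int_sum_ord n (F : nat -> R) e :
  (forall i, (i < n)%N -> near_int e (F i)) ->
  near_int (n%:R * e) (\sum_(i < n) F i).
Proof.
move=> Fe; have := @near_int_sum 'I_n (index_enum _) predT F (fun=> e).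
by rewrite sumr_const card_ord mulr_natl; apply=> i _; apply: Fe.
Qed.

(* The index of the arc [[c / 2 ^ T, (c + 1) / 2 ^ T)] of the circle containing [x]. *)
Definition cell T x : 'I_(2 ^ T) :=
  Ordinal (ltn_pmod `|(Num.floor (2 ^+ T * x) %% (2 ^ T)%N%:Z)%Z|%N (expn_gt0 2 T)).

Lemma cell_eq T x y : cell T x = cell T y -> near_int (2 ^- T) (x - y).
Proof.
move/(congr1 val) => /=; set a := Num.floor _; set b := Num.floor _.
have q0 : (2 ^ T)%N%:Z != 0 by rewrite eqz_nat -lt0n expn_gt0.
have norm_mod z : (`|(z %% (2 ^ T)%N%:Z)%Z| %% 2 ^ T = `|(z %% (2 ^ T)%N%:Z)%Z|)%N.
  by rewrite modn_small // -ltz_nat gez0_abs ?modz_ge0 // ltz_pmod // ltz_nat expn_gt0.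
(* Equal residues mean that the two floors differ by [2 ^ T] times this integer, and rounding down
   changes the scaled difference by less than 1. *)
rewrite !norm_mod => eqab; exists ((a %/ (2 ^ T)%N%:Z)%Z - (b %/ (2 ^ T)%N%:Z)%Z).
have {}eqab : (a %% (2 ^ T)%N%:Z)%Z = (b %% (2 ^ T)%N%:Z)%Z.
  by rewrite -(gez0_abs (modz_ge0 a q0)) -(gez0_abs (modz_ge0 b q0)) eqab.
have p0 : 0 < 2 ^+ T :> R by rewrite exprn_gt0.
have Eab : (a%:~R - b%:~R : R) =
    ((a %/ (2 ^ T)%N%:Z)%Z - (b %/ (2 ^ T)%N%:Z)%Z)%:~R * 2 ^+ T.
  have -> : (2 ^+ T : R) = (2 ^ T)%N%:Z%:~R by rewrite -pmulrn natrX.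
  rewrite -intrM -intrB; congr _%:~R.
  by rewrite {1}(divz_eq a (2 ^ T)%N) {1}(divz_eq b (2 ^ T)%N) eqab; ring.
have /andP[a1 a2] := floor_itv (2 ^+ T * x).
have /andP[b1 b2] := floor_itv (2 ^+ T * y).
rewrite -/a -/b !intrD in a1 a2 b1 b2.
rewrite -(ler_pM2l p0) divff ?gt_eqF // -{1}(gtr0_norm p0) -normrM.
set z := _%:~R in Eab *; rewrite ler_norml; apply/andP; split; lra.
Qed.

(** Pigeonhole: the multipliers [0, ..., 2 ^ (T * d)] outnumber the tuples of cells by one, and [M]
    is the difference of two that share a tuple. *)
Lemma dirichlet d (b : 'I_d -> R) T :
  exists2 M, (0 < M <= 2 ^ (T * d))%N & forall j, near_int (2 ^- T) (M%:R * b j).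
Proof.
pose f (n : 'I_(2 ^ (T * d)).+1) := [ffun j => cell T (n%:R * b j)].
have /injectivePn[n [n' nn' fn]] : ~~ injectiveb f.
  apply/negP => /injectiveP/leq_card.
  by rewrite card_ffun !card_ord -expnM ltnn.
wlog lt_n : n n' nn' fn / (n < n')%N.
  move=> H; case: (ltngtP n n') => [|lt|/val_inj eqn]; first exact: H.
    by apply: (H n' n) => //; rewrite eq_sym.
  by rewrite eqn eqxx in nn'.
exists (n' - n)%N; first by have := ltn_ord n'; lia.
move=> j; rewrite natrB ?(ltnW lt_n) // mulrBl; apply: cell_eq.
by have /ffunP/(_ j) := fn; rewrite !ffunE.
Qed.

(** Expanding one factor at a time gives [i ^ c] monomials, each an element of [products u i c] with
    a weight of at most [B ^ c]; hence the factor [(i * B) ^ c] in the error. *)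
Lemma near_int_power (u X : nat -> nat) i c B (eta g : R) : 0 <= eta ->
    (forall l, (l < i)%N -> X l <= B)%N ->
    (forall p, p \in products u i c -> near_int eta (p%:R * g)) ->
  near_int ((i * B)%N%:R ^+ c * eta) ((\sum_(l < i) X l * u l)%N%:R ^+ c * g).
Proof.
move=> eta0 XB; elim: c g => [|c IHc] g H.
  by rewrite !expr0 mul1r -[1]/(1%N%:R); apply: H; rewrite inE.
have -> : (i * B)%N%:R ^+ c.+1 * eta = i%:R * (B%:R * ((i * B)%N%:R ^+ c * eta)).
  by rewrite exprS natrM; ring.
set y := (\sum_(l < i) X l * u l)%N in IHc *.
have Ey : y%:R = \sum_(l < i) (X l * u l)%N%:R :> R by rewrite natr_sum.
rewrite exprS -mulrA {1}Ey big_distrl /=.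
apply: (near_int_sum_ord (F := fun l => (X l * u l)%N%:R * (y%:R ^+ c * g))) => l li.
apply: (@near_int_le ((X l)%:R * ((i * B)%N%:R ^+ c * eta))).
  by rewrite ler_wpM2r ?ler_nat ?XB // mulr_ge0 // exprn_ge0.
rewrite [(X l * u l)%N%:R]natrM -mulrA; apply: near_intMn; rewrite mulrCA.
apply: IHc => p pc; rewrite mulrA -natrM; apply: H => /=.
by rewrite mulnC; apply: allpairs_f; rewrite ?mem_iota.
Qed.

End NearInteger.

(** * The induction on the exponent *)

Section PowerRecurrence.
Variable R : archiRealFieldType.

(** Binomial expansion in the last summand: the terms [b = 0] and [b = a] are subtracted, and
    [near_int_power] treats the others. Their errors ['C(a, b) * B ^ b * (i * B) ^ (a - b) * eta]
    add up, by the binomial formula read backwards, to at most [(i.+1 * B) ^ a * eta]. *)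
Lemma near_int_cross (u X : nat -> nat) i a B (eta g : R) : 0 <= eta -> (0 < a)%N ->
    (forall l, (l <= i)%N -> X l <= B)%N ->
    (forall b p, (0 < b < a)%N -> p \in products u i (a - b) ->
       near_int eta (p%:R * ((u i)%:R ^+ b * g))) ->
  near_int ((i.+1 * B)%N%:R ^+ a * eta)
    ((\sum_(l < i.+1) X l * u l)%N%:R ^+ a * g
     - (\sum_(l < i) X l * u l)%N%:R ^+ a * g - (X i)%:R ^+ a * ((u i)%:R ^+ a * g)).
Proof.
move=> eta0 a0 XB H; rewrite big_ord_recr /= natrD; set y := (\sum_(l < i) _)%N.
have max0 : (ord_max : 'I_a.+1) != ord0 by rewrite -val_eqE /= -lt0n.
rewrite exprDn (bigD1 ord0) //= (bigD1 ord_max) /= ?max0 //.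
rewrite subn0 subnn bin0 binn !mulr1n !expr0 mulr1 mul1r.
rewrite [(X i * u i)%N%:R]natrM [(_ * _) ^+ a]exprMn.
set S := (X in _ + (_ + X)).
have -> : (y%:R ^+ a + ((X i)%:R ^+ a * (u i)%:R ^+ a + S)) * g - y%:R ^+ a * g
    - (X i)%:R ^+ a * ((u i)%:R ^+ a * g) = S * g by ring.
rewrite big_distrl /=.
pose e (b : 'I_a.+1) : R := ('C(a, b) * X i ^ b)%N%:R * ((i * B)%N%:R ^+ (a - b) * eta).
apply: (@near_int_le _ (\sum_(b < a.+1 | (b != ord0) && (b != ord_max)) e b)); last first.
  apply: near_int_sum => b /andP[b0 bmax].
  have ba : (0 < b < a)%N.
    by have := ltn_ord b; move: b0 bmax; rewrite -!val_eqE /=; lia.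
  have -> : y%:R ^+ (a - b) * ((X i)%:R * (u i)%:R) ^+ b *+ 'C(a, b) * g
      = ('C(a, b) * X i ^ b)%N%:R * (y%:R ^+ (a - b) * ((u i)%:R ^+ b * g)).
    by rewrite !natrM natrX exprMn -mulr_natl; ring.
  apply/near_intMn/near_int_power => // [l li|p]; first exact/XB/ltnW.
  exact: H.
rewrite mulSn addnC natrD exprDn big_distrl big_mkcond /=; apply: ler_sum => b _.
have -> : (i * B)%N%:R ^+ (a - b) * B%:R ^+ b *+ 'C(a, b) * eta
    = ('C(a, b) * B ^ b)%N%:R * ((i * B)%N%:R ^+ (a - b) * eta) :> R.
  by rewrite !natrM natrX exprMn -mulr_natl; ring.
case: ifP => _; last by rewrite !mulr_ge0 // exprn_ge0.
rewrite ler_wpM2r ?mulr_ge0 ?exprn_ge0 // ler_nat leq_mul2l; apply/orP; right.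
by case: (val b) => // c; rewrite leq_exp2r // XB.
Qed.

(** Telescoping of [near_int_cross] over the [m] summands, with the error of each step enlarged to
    its value at the last one. *)
Lemma near_int_diagonal (u X : nat -> nat) m a B (eta g : R) : 0 <= eta -> (0 < a)%N ->
    (forall l, (l < m)%N -> X l <= B)%N ->
    (forall i b p, (i < m)%N -> (0 < b < a)%N -> p \in products u i (a - b) ->
       near_int eta (p%:R * ((u i)%:R ^+ b * g))) ->
  near_int (m%:R * ((m * B)%N%:R ^+ a * eta))
    ((\sum_(l < m) X l * u l)%N%:R ^+ a * g
     - \sum_(l < m) (X l)%:R ^+ a * ((u l)%:R ^+ a * g)).
Proof.
move=> eta0 a0 XB H; set e := (m * B)%N%:R ^+ a * eta.
suff /(_ m (leqnn m)) : forall j, (j <= m)%N -> near_int (j%:R * e)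
  ((\sum_(l < j) X l * u l)%N%:R ^+ a * g
     - \sum_(l < j) (X l)%:R ^+ a * ((u l)%:R ^+ a * g)) by [].
elim=> [|j IHj] jm.
  by rewrite !big_ord0 expr0n (gtn_eqF a0) !mul0r subrr; apply: near_int0.
have jle : near_int e ((\sum_(l < j.+1) X l * u l)%N%:R ^+ a * g
     - (\sum_(l < j) X l * u l)%N%:R ^+ a * g - (X j)%:R ^+ a * ((u j)%:R ^+ a * g)).
  apply: near_int_le (near_int_cross (B := B) eta0 a0 _ _) => [|l lj|b p]; last exact: H.
    apply: ler_wpM2r => //; apply: lerXn2r; rewrite ?nnegrE ?ler0n //.
    by rewrite ler_nat leq_mul2r jm orbT.
  by apply: XB; apply: leq_ltn_trans lj jm.
have := near_intD jle (IHj (ltnW jm)).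
have -> : j.+1%:R * e = e + j%:R * e by rewrite -natr1; ring.
rewrite [\sum_(l < j.+1) _ ^+ a * _]big_ord_recr /=.
by congr near_int; ring.
Qed.

Lemma exprV2_split n : 2 ^- n.+1 + 2 ^- n.+1 = 2 ^- n :> R.
Proof. by rewrite exprS; field; rewrite expf_neq0 ?pnatr_eq0. Qed.

Lemma near_zero_sum K d x (b : 'I_(num_terms K x) -> 'I_d -> R) : (0 < K)%N ->
    (d <= x)%N ->
  exists X : 'I_(num_terms K x) -> nat,
    [/\ forall l, (X l <= 2 ^ weight_bits x)%N, exists l, (0 < X l)%N &
        forall j, near_int (2 ^- x.+1) (\sum_l (X l)%:R ^+ K * b l j)].
Proof.
move=> K0 dx; set h := weight_bits x; set T := cell_bits x.
pose sg (P : {set 'I_(num_terms K x)}) j := \sum_(l in P) b l j.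
(* The colour of an index set records the cells of all its [d] sums. *)
pose color P := [ffun j => cell T (sg P j)].
have cardC : (#|{ffun 'I_d -> 'I_(2 ^ T)}| <= 2 ^ (T * x))%N.
  by rewrite card_ffun !card_ord -expnM leq_exp2l // leq_mul2l dx orbT.
have r0 : (0 < 2 ^ K * h)%N by rewrite muln_gt0 expn_gt0.
have [core [G [ltG tG G0 dG colG]]] := monochromatic_petals color cardC (card_ord _) r0.
have [P0 GP0] : exists P, P \in G by apply/card_gt0P; apply: leq_trans ltG.
(* The core is disjoint from each petal, so its sum cancels when two petals with the same colour are
   compared. *)
have near_sg P j : P \in G -> near_int (2 ^- T) (sg P j - sg P0 j).
  move=> GP; have sgU Q : Q \in G -> sg (core :|: Q) j = sg core j + sg Q j.
    move=> GQ; rewrite -bigU ?dG //; apply: eq_bigl => l.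
    by rewrite !inE.
  have -> : sg P j - sg P0 j = sg (core :|: P) j - sg (core :|: P0) j.
    by rewrite !sgU //; ring.
  by apply: cell_eq; have /ffunP/(_ j) := colG _ _ GP GP0; rewrite !ffunE.
have [M /andP[M0 leM] nearM] := dirichlet (sg P0) x.+2.
have ltM : (M < 2 ^ h)%N.
  apply: leq_ltn_trans leM _; rewrite ltn_exp2l // ltnS leq_mul2l dx orbT //.
have [xs les eqM] := sum_of_powers K0 ltM.
have [w] := sum_powers_assign K0 (leq_trans les (ltnW ltG)); rewrite eqM => eqw.
have w_le P : P \in G -> (w P <= M)%N.
  move=> GP; rewrite -eqw (bigD1 P) //=; apply: leq_trans (leq_addr _ _).
  by case: (w P) => // c; rewrite -{1}(expn1 c.+1) leq_pexp2l.
(* The weight is constant on each petal and 0 off the petals. *)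
pose X l := if l \in cover G then w (pblock G l) else 0%N.
exists X; split.
- move=> l; rewrite /X; case: ifP => // lG; apply: leq_trans (ltnW ltM).
  by apply: w_le; apply: pblock_mem.
- have [P GP wP] : exists2 P, P \in G & (0 < w P)%N.
    apply/exists_inP; apply: contraLR M0; rewrite negb_exists_in => /forall_inP w0.
    rewrite -eqw big1 // => P GP; have := w0 P GP; rewrite -eqn0Ngt => /eqP->.
    by rewrite exp0n.
  have /set0Pn[l Pl] : P != set0 by apply: contraNneq G0 => <-.
  exists l; rewrite /X (def_pblock tG GP Pl) ifT //.
  by apply/bigcupP; exists P.
(* The numbers [w P ^ K] add up to [M], so replacing each petal sum by that of [P0] leaves
   [M%:R * sg P0 j] and differences of size at most [2 ^- T] modulo 1. *)
move=> j; have -> : \sum_l (X l)%:R ^+ K * b l j =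
    M%:R * sg P0 j + \sum_(P in G) (w P ^ K)%N%:R * (sg P j - sg P0 j).
  transitivity (\sum_(P in G) (w P ^ K)%N%:R * sg P j).
    rewrite (bigID (mem (cover G))) /= [X in _ + X]big1 ?addr0; last first.
      by move=> l /negbTE lG; rewrite /X lG expr0n gtn_eqF // mul0r.
    rewrite big_trivIset //=; apply: eq_bigr => P GP; rewrite big_distrr /=.
    apply: eq_bigr => l Pl; rewrite /X (def_pblock tG GP Pl) natrX ifT //.
    by apply/bigcupP; exists P.
  rewrite -eqw natr_sum big_distrl /= -big_split /=.
  by apply: eq_bigr => P _; ring.
rewrite -exprV2_split; apply: near_intD; first exact: nearM.
have: near_int (\sum_(P in G) (w P ^ K)%N%:R * 2 ^- T)
        (\sum_(P in G) (w P ^ K)%N%:R * (sg P j - sg P0 j)).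
  by apply: near_int_sum => P GP; apply/near_intMn/near_sg.
apply: near_int_le; rewrite -big_distrl /= -natr_sum eqw.
(* As [cell_bits x] is [h + x.+2] and [M < 2 ^ h], the error [M * 2 ^- T] is at most [2 ^- x.+2]. *)
rewrite ler_pdivrMr ?exprn_gt0 // mulrC exprD mulfK ?expf_neq0 ?pnatr_eq0 //.
by rewrite -natrX ler_nat ltnW.
Qed.

(** A condition is a pair (exponent, coefficient). One parameter [x] bounds the number of conditions
    and is also the number of bits of precision; exponents are mixed because the cross terms of a
    power involve all smaller ones. *)
Definition recurrent k E := forall x (s : seq (nat * R)), (2 <= x)%N ->
  (size s <= x)%N -> (forall p, p \in s -> 0 < p.1 <= k)%N ->
  exists n, [/\ (0 < n)%N, (n <= 2 ^ (x ^ E))%N &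
    forall p, p \in s -> near_int (2 ^- x) (n%:R ^+ p.1 * p.2)].

(** Every cross term has exponent [b <= k] in the new [u i], so the earlier factors can be moved
    into the coefficient and the hypothesis for [k] applies. Natural subtraction matters: for
    [b >= p.1] the only product is 1, so [(u i) ^ b] times the coefficient itself is nearly an
    integer. *)
Lemma cross_free_sequence k E x m L (s : seq (nat * R)) :
    recurrent k E -> (size s <= x)%N -> (forall p, p \in s -> p.1 <= k.+1)%N ->
    (2 <= L)%N ->
  exists u : nat -> nat, forall i, (i < m)%N ->
    [/\ (0 < u i)%N, (u i <= 2 ^ ((L + x * k * m.+1 ^ k.+1) ^ E))%N &
        forall p b q, p \in s -> (0 < b <= k)%N -> q \in products u i (p.1 - b) ->
          near_int (2 ^- L) (q%:R * ((u i)%:R ^+ b * p.2))].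
Proof.
(* [y] serves both as precision, being at least [L], and as a bound on the number of conditions. The
   base [m.+1] is positive, so its powers increase with the exponent. *)
move=> rec sx sk L2; set y := (L + _)%N.
apply: (@prefix_choice (fun u i n => [/\ (0 < n)%N, (n <= 2 ^ (y ^ E))%N &
  forall p b q, p \in s -> (0 < b <= k)%N -> q \in products u i (p.1 - b) ->
    near_int (2 ^- L) (q%:R * (n%:R ^+ b * p.2))])).
  move=> u v i n uv [n0 ny H]; split=> // p b q ps bk.
  by rewrite -(eq_products _ uv); apply: H.
move=> u i im.
pose pairs := [seq (p, b) | p <- s, b <- iota 1 k].
pose s' := [seq (pb.2, q%:R * pb.1.2) | pb <- pairs, q <- products u i (pb.1.1 - pb.2)].
have pairsP pb : pb \in pairs -> (pb.1 \in s) /\ (0 < pb.2 <= k)%N.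
  by case/allpairsP => -[p b] /= [ps]; rewrite mem_iota => bk ->; split=> //=; lia.
have [|||n [n0 ny H]] := rec y s'.
- by rewrite /y; lia.
- apply: (@leq_trans (size pairs * m.+1 ^ k.+1)).
    apply: size_allpairs_leq => pb /pairsP[/sk pk _]; rewrite size_products.
    apply: (@leq_trans (m.+1 ^ (pb.1.1 - pb.2))); last first.
      by rewrite leq_pexp2l // (leq_trans (leq_subr _ _)).
    by case: (_ - _)%N => // c; rewrite leq_exp2r //; lia.
  rewrite /y; apply: leq_trans (leq_addl _ _); rewrite leq_mul2r.
  by rewrite size_allpairs size_iota leq_mul2r sx !orbT.
- by move=> p /allpairsPdep[pb [q [/pairsP[_ ?] _ ->]]].
exists n; split=> // p b q ps bk qp.
have -> : q%:R * (n%:R ^+ b * p.2) = n%:R ^+ b * (q%:R * p.2) by ring.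
apply: near_int_le (H (b, q%:R * p.2) _).
  by rewrite lef_pV2 ?posrE ?exprn_gt0 // ler_eXn2l ?leq_addr // ltr1n.
apply/allpairsPdep; exists (p, b), q; split=> //.
by apply: allpairs_f; rewrite // mem_iota; lia.
Qed.

(** The extra [m + (m + h) * K] bits of precision absorb the factor in front, because
    [m < 2 ^ m]. *)
Lemma diagonal_error m h K a x : (a <= K)%N ->
  m%:R * ((m * 2 ^ h)%N%:R ^+ a * 2 ^- (x + (m + (m + h) * K))) <= 2 ^- x :> R.
Proof.
move=> aK; rewrite mulrA ler_pdivrMr ?exprn_gt0 // exprD mulKf ?expf_neq0 ?pnatr_eq0 //.
rewrite -!natrX -natrM ler_nat expnD leq_mul ?(ltnW (ltn_expl _ _)) //.
apply: (@leq_trans ((2 ^ (m + h)) ^ a)); last by rewrite -expnM leq_exp2l // leq_mul2l aK orbT.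
case: a {aK} => // a; rewrite leq_exp2r // expnD leq_mul2r ltnW ?orbT //.
exact: ltn_expl.
Qed.

Lemma recurrentS k E : recurrent k E -> exists E', recurrent k.+1 E'.
Proof.
move=> rec; have [E' leE'] := poly_bounded_step k E.
exists E' => x s x2 sx sk; have {leE'} := leE' x x2; cbv zeta.
set K := k.+1; set m := num_terms K x; set h := weight_bits x.
set L := (x.+2 + _)%N; set y := (L + _)%N => leE'.
have sk' p : p \in s -> (p.1 <= K)%N by case/sk/andP.
have [u uP] := cross_free_sequence m rec sx sk' (isT : (2 <= L)%N).
pose al (j : 'I_(size s)) := (nth (0%N, 0) s j).2.
have [X [XB [l0 Xl0] nearX]] :=
  near_zero_sum (fun (l : 'I_m) j => (u l)%:R ^+ K * al j) (ltn0Sn k) sx.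
pose X' l := if insub l is Some o then X o else 0%N.
have X'E (o : 'I_m) : X' o = X o by rewrite /X' valK.
have X'B l : (X' l <= 2 ^ h)%N by rewrite /X'; case: insub => // o; apply: XB.
exists (\sum_(l < m) X' l * u l)%N; split.
- have [u0 _ _] := uP l0 (ltn_ord l0).
  by rewrite (bigD1 l0) //= X'E addn_gt0 muln_gt0 Xl0 u0.
- apply: (@leq_trans (\sum_(l < m) 2 ^ h * 2 ^ (y ^ E))%N).
    by apply: leq_sum => l _; apply: leq_mul => //; case: (uP l (ltn_ord l)).
  rewrite sum_nat_const card_ord.
  apply: leq_trans (_ : 2 ^ (m + h + y ^ E) <= _)%N; last by rewrite leq_exp2l.
  rewrite (expnD 2 (m + h)) (expnD 2 m) -mulnA leq_mul2r; apply/orP; right.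
  exact/ltnW/ltn_expl.
move=> p ps; have /andP[a0 aK] := sk p ps.
have eta0 : 0 <= 2 ^- L :> R by rewrite invr_ge0 exprn_ge0.
have diag : near_int (2 ^- x.+2) ((\sum_(l < m) X' l * u l)%N%:R ^+ p.1 * p.2
     - \sum_(l < m) (X' l)%:R ^+ p.1 * ((u l)%:R ^+ p.1 * p.2)).
  apply: near_int_le (diagonal_error m h x.+2 aK) _.
  apply: near_int_diagonal => // i b q im bp.
  have [_ _ H] := uP i im; apply: H => //.
  by case/andP: bp => -> bp; rewrite -ltnS (leq_trans bp).
rewrite -[_ * p.2](subrK (\sum_(l < m) (X' l)%:R ^+ p.1 * ((u l)%:R ^+ p.1 * p.2))).
have le_x : 2 ^- x.+2 + 2 ^- x.+1 <= 2 ^- x :> R.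
  rewrite -(exprV2_split x) lerD2r lef_pV2 ?posrE ?exprn_gt0 //.
  by rewrite ler_eXn2l // ltr1n.
apply: near_int_le le_x _; apply: near_intD => //.
(* For the top exponent the weights make the diagonal sum nearly an integer; for a smaller exponent
   each diagonal term already is, by the choice of [u]. *)
have [eqK|neqK] := eqVneq p.1 K.
  have js : (index p s < size s)%N by rewrite index_mem.
  have := nearX (Ordinal js); congr near_int; apply: eq_bigr => l _.
  by rewrite X'E eqK /al /= nth_index.
apply: (@near_int_le _ (2 ^- x.+2)).
  by rewrite lef_pV2 ?posrE ?exprn_gt0 // ler_eXn2l // ltr1n.
apply: near_int_le (diagonal_error m h x.+2 aK) _.
(* The weights are bounded crudely by [m * 2 ^ h] so that [diagonal_error] serves again. *)
apply: (near_int_sum_ord (F := fun l => (X' l)%:R ^+ p.1 * ((u l)%:R ^+ p.1 * p.2))).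
move=> l lm; apply: (@near_int_le _ ((X' l ^ p.1)%N%:R * 2 ^- L)).
  apply: ler_wpM2r => //; rewrite -natrX ler_nat leq_exp2r //.
  by apply: leq_trans (X'B l) _; rewrite leq_pmull // (leq_ltn_trans _ lm).
rewrite -[(X' l)%:R ^+ _]natrX; apply: near_intMn; have [_ _ H] := uP l lm.
(* The case [b = p.1], where the product of earlier terms is the empty product 1. *)
rewrite -[_ * p.2]mul1r; apply: (H p p.1 1%N) => //.
  by rewrite a0 -ltnS ltn_neqAle neqK.
by rewrite subnn inE.
Qed.

Lemma recurrent_ex k : exists E, recurrent k E.
Proof.
elim: k => [|k [E recE]]; last exact: recurrentS recE.
exists 0%N => x s _ _ s0.
exists 1%N; split=> // p /s0/andP[p0 p1].
by have := leq_trans p0 p1.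
Qed.

End PowerRecurrence.

(** * Transfer to the standard library numbers *)

Lemma Nat_powE m n : Nat.pow m n = (m ^ n)%N.
Proof. by elim: n => //= n ->; rewrite expnS. Qed.

Lemma intr_IZR (z : int) : exists z' : Z, IZR z' = z%:~R.
Proof.
case: z => n; first by exists (Z.of_nat n); rewrite -INR_IZR_INZ INRE.
by exists (Z.opp (Z.of_nat n.+1)); rewrite opp_IZR -INR_IZR_INZ INRE NegzE mulrNz.
Qed.

(** All exponents equal [k] here. The exponent is raised to [E.+1] so that it is positive, as
    [iterated_power_bracket] requires. *)
Lemma power_recurrence k : (0 < k)%N ->
  exists E : nat, forall (d x : nat) (alpha : nat -> Rdefinitions.R),
    (2 <= x)%coq_nat -> (d <= x)%coq_nat ->
    exists n : nat, [/\ (1 <= n)%coq_nat, (n <= Nat.pow 2 (Nat.pow x E.+1))%coq_nat &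
      forall j, (j < d)%coq_nat -> exists z : Z,
        Rle (Rabs (Rminus (Rmult (pow (INR n) k) (alpha j)) (IZR z))) (pow (Rinv (IZR 2)) x)].
Proof.
move=> k0; have [E rec] := recurrent_ex Rdefinitions.R k; exists E => d x alpha x2 dx.
have [|||n [n0 nE nP]] := rec x [seq (k, alpha j) | j <- iota 0 d].
- exact/ssrnat.leP.
- by rewrite size_map size_iota; apply/ssrnat.leP.
- by move=> p /mapP[j _ ->] /=; rewrite k0 /=.
exists n; split; first exact/ssrnat.leP.
  apply/ssrnat.leP; rewrite !Nat_powE; apply: leq_trans nE _.
  by rewrite leq_exp2l // leq_exp2l //; apply/ssrnat.leP.
move=> j /ssrnat.ltP jd; have [|z nz] := nP (k, alpha j).
  by apply: map_f; rewrite mem_iota.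
have [z' Ez'] := intr_IZR z; exists z'.
apply/RleP; rewrite Ez' RabsE RminusE RmultE !RpowE INRE.
suff -> : (Rinv (IZR 2) ^+ x)%R = (2 ^- x)%R by [].
by rewrite exprVn.
Qed.

End Recurrence.

(** * Distance to the nearest integer, and the choice of [x] in terms of [N] *)

Lemma dist_nint_le_dist (y : R) (z : Z) : dist_nint y <= Rabs (y - IZR z).
Proof.
  unfold dist_nint.
  destruct (Z_le_gt_dec z (up y - 1)) as [Hz | Hz].
  - apply Rle_trans with (1 := Rmin_l _ _); apply IZR_le in Hz.
    apply Rle_trans with (2 := Rle_abs _); lra.
  - apply Rle_trans with (1 := Rmin_r _ _).
    assert (Hz' : IZR (up y) <= IZR z) by (apply IZR_le; lia).
    rewrite Rabs_minus_sym; apply Rle_trans with (2 := Rle_abs _); lra.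
Qed.

Lemma dist_nint_le_1 (y : R) : dist_nint y <= 1.
Proof.
  apply Rle_trans with (1 := Rmin_r _ _); destruct (archimed y); lra.
Qed.

Lemma exp_le_mono (x y : R) : x <= y -> exp x <= exp y.
Proof.
  intros [H | ->]; [left; apply exp_increasing; exact H | right; reflexivity].
Qed.

Lemma last_failure (P : nat -> bool) (n : nat) :
  P 0%nat = false -> P n = true -> exists x, P x = false /\ P (S x) = true.
Proof.
  intros H0; induction n as [|n IH]; intros Hn; [congruence|].
  destruct (P n) eqn:Pn; eauto.
Qed.

(** The inequality [N < 2 ^ (x ^ F)] fails at [x = 0], where [0 ^ F = 0], and holds at [x = N]; [x]
    is a place where it switches. *)
Lemma iterated_power_bracket (F N : nat) : (1 <= F)%nat -> (1 <= N)%nat ->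
  exists x, (2 ^ (x ^ F) <= N)%nat /\ (N < 2 ^ (S x ^ F))%nat.
Proof.
  intros HF HN.
  destruct (last_failure (fun x => Nat.ltb N (2 ^ (x ^ F))) N) as [x [Hx HSx]].
  - apply Nat.ltb_ge; rewrite Nat.pow_0_l by lia; simpl; lia.
  - apply Nat.ltb_lt, Nat.lt_le_trans with (2 ^ N)%nat.
    + apply Nat.pow_gt_lin_r; lia.
    + apply Nat.pow_le_mono_r; [lia|].
      rewrite <- (Nat.pow_1_r N) at 1; apply Nat.pow_le_mono_r; lia.
  - exists x; apply Nat.ltb_ge in Hx; apply Nat.ltb_lt in HSx; auto.
Qed.

(** Since [ln 2 <= 1], the logarithm of [N] is at most [(x + 1) ^ F], and the root of order [C >= F]
    brings this down to [x + 1]. *)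
Lemma rpow0_ln_le (F N x : nat) (C : R) : INR F <= C -> 0 < C ->
  (1 <= N)%nat -> (N < 2 ^ (S x ^ F))%nat ->
  0 <= rpow0 (ln (INR N)) (/ C) <= INR (S x).
Proof.
  intros HF HC HN Hx; unfold rpow0.
  destruct (Rle_dec (ln (INR N)) 0) as [H | H]; [split; [lra | apply pos_INR]|].
  split; [apply Rlt_le, exp_pos|].
  assert (HSx : 1 <= INR (S x)) by (rewrite S_INR; pose proof (pos_INR x); lra).
  assert (HN0 : 0 < INR N) by (apply lt_0_INR; lia).
  assert (Hln : ln (INR N) <= Rpower (INR (S x)) (INR F)).
  { rewrite Rpower_pow by lra; rewrite <- pow_INR.
    apply lt_INR in Hx; rewrite pow_INR in Hx.
    apply ln_increasing in Hx; auto.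
    rewrite ln_pow in Hx by (simpl; lra).
    apply Rle_trans with (1 := Rlt_le _ _ Hx); rewrite <- Rmult_1_r.
    apply Rmult_le_compat_l; [apply pos_INR|].
    rewrite <- (ln_exp 1); apply Rlt_le, ln_increasing; [simpl; lra|].
    pose proof (exp_ineq1 1); simpl; lra. }
  apply Rle_trans with (Rpower (Rpower (INR (S x)) (INR F)) (/ C)).
  - apply Rle_Rpower_l; [apply Rlt_le, Rinv_0_lt_compat; auto | lra].
  - rewrite Rpower_mult; rewrite <- (Rpower_1 (INR (S x))) at 2 by lra.
    apply Rle_Rpower; [exact HSx|].
    apply Rmult_le_reg_r with C; [auto|].
    rewrite Rmult_assoc, Rinv_l, Rmult_1_r, Rmult_1_l by lra; auto.
Qed.

Theorem theorem2 :
  forall k : nat, (1 <= k)%nat ->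
  exists C A : R, 1 <= C /\ 0 < A /\
    forall (d : nat) (alpha : nat -> R) (N : nat),
      (1 <= d)%nat -> (1 <= N)%nat ->
      exists n : nat, (1 <= n)%nat /\ (n <= N)%nat /\
        forall j : nat, (j < d)%nat ->
          dist_nint (INR n ^ k * alpha j)
            <= A * exp (- (/ (C * INR d ^ 5)) * rpow0 (ln (INR N)) (/ C)).
Proof.
  intros k Hk.
  destruct (@Recurrence.power_recurrence k) as [E HE].
  { destruct k; [lia | reflexivity]. }
  (* [S E] meets the requirement [INR F <= C] of [rpow0_ln_le]; the extra 2 makes [C * INR d ^ 5] at
     least [3 * INR d]. The factor [exp 1] pays for the cases of small [x]. *)
  set (C := INR (S E) + 2).
  assert (HC : 3 <= C) by (unfold C; rewrite S_INR; pose proof (pos_INR E); lra).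
  exists C, (exp 1); split; [lra|]; split; [apply exp_pos|].
  intros d alpha N Hd HN.
  destruct (iterated_power_bracket (S E) N) as [x [Hx HSx]]; [lia | auto |].
  destruct (rpow0_ln_le (S E) N x C) as [Hr0 Hr1]; [unfold C; lra | lra | auto | auto |].
  set (r := rpow0 (ln (INR N)) (/ C)) in *.
  assert (Hd1 : 1 <= INR d) by (apply (le_INR 1); auto).
  assert (Hd5 : INR d <= INR d ^ 5).
  { rewrite <- (pow_1 (INR d)) at 1; apply Rle_pow; [auto | lia]. }
  assert (HCd3 : 3 * INR d <= C * INR d ^ 5) by (apply Rmult_le_compat; lra).
  assert (HCd : 0 < C * INR d ^ 5) by lra.
  rewrite S_INR in Hr1.
  assert (Hl : forall b, r <= b * (C * INR d ^ 5) -> / (C * INR d ^ 5) * r <= b).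
  { intros b Hb; apply Rmult_le_reg_l with (1 := HCd).
    rewrite <- Rmult_assoc, Rinv_r, Rmult_1_l by lra; lra. }
  rewrite Ropp_mult_distr_l_reverse, <- exp_plus.
  destruct (le_lt_dec 2 x) as [H2 | H2]; [destruct (le_lt_dec d x) as [Hdx | Hdx]|].
  - destruct (HE d x alpha H2 Hdx) as [n [Hn1 HnE Hn]].
    exists n; split; [exact Hn1|]; split; [lia|]; intros j Hj.
    destruct (Hn j Hj) as [z Hz].
    apply Rle_trans with (1 := dist_nint_le_dist _ z).
    apply Rle_trans with (1 := Hz).
    assert (Hln2 : / 2 < ln 2) by apply ln_lt_2.
    rewrite <- (exp_ln (/ 2)), <- Rpower_pow by (try apply exp_pos; lra).
    unfold Rpower; rewrite ln_exp, ln_Rinv by lra.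
    pose proof (pos_INR x).
    (* With [ln 2 > 1 / 2] this suffices: [- x * ln 2 <= - x / 2 <= 1 - (x + 1) / 2]. *)
    assert (/ (C * INR d ^ 5) * r <= (INR x + 1) / 2).
    { apply Hl; nra. }
    apply exp_le_mono; nra.
  (* If [x < d], then [r <= x + 1 <= d], so the right-hand side is at least 1 and [n = 1] works. *)
  - exists 1%nat; split; [lia|]; split; [lia|]; intros j Hj.
    apply Rle_trans with (1 := dist_nint_le_1 _).
    assert (/ (C * INR d ^ 5) * r <= 1).
    { apply Hl; apply (le_INR (S x)) in Hdx; rewrite S_INR in Hdx; lra. }
    rewrite <- exp_0 at 1; apply exp_le_mono; lra.
  (* If [x <= 1], then [r <= 2] and the bound is again at least 1. *)
  - exists 1%nat; split; [lia|]; split; [lia|]; intros j Hj.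
    apply Rle_trans with (1 := dist_nint_le_1 _).
    assert (/ (C * INR d ^ 5) * r <= 1).
    { assert (INR x <= 1) by (apply (le_INR x 1); lia).
      apply Hl; lra. }
    rewrite <- exp_0 at 1; apply exp_le_mono; lra.
Qed.
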